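(* $$\frac{1}{-1+2\log(2)}=\mathrm{CF}\left[3n+3,\,-2n^2\right].$$
   Context: For sequences $(a_n)_{n\ge0}$, $(b_n)_{n\ge1}$, $\mathrm{CF}[a_n,b_n]$ denotes the continued fraction $a_0+\cfrac{b_1}{a_1+\cfrac{b_2}{a_2+\ddots}}$, whose value is $\lim_{n\to\infty}A_n/B_n$, where $A_0=1$, $A_1=a_0$, $B_0=0$, $B_1=1$, and $A_{n+1}=a_nA_n+b_nA_{n-1}$, $B_{n+1}=a_nB_n+b_nB_{n-1}$ for $n\ge1$. $\log$ is the natural logarithm. *)

(* Defs.v *)
From Stdlib Require Import Reals.
From Coquelicot Require Import Coquelicot.
Open Scope R_scope.

(** Continued fractions a 0 + b 1 / (a 1 + b 2 / (a 2 + ...)).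
    The partial numerators are indexed from 1, so [b 0] is never used. *)

(** A_0 = 1, A_1 = a_0, A_{n+1} = a_n A_n + b_n A_{n-1} for n >= 1. *)
Fixpoint CF_num (a b : nat -> R) (n : nat) : R :=
  match n with
  | O => 1
  | S m => match m with
           | O => a O
           | S k => a m * CF_num a b m + b m * CF_num a b k
           end
  end.

(** B_0 = 0, B_1 = 1, B_{n+1} = a_n B_n + b_n B_{n-1} for n >= 1. *)
Fixpoint CF_den (a b : nat -> R) (n : nat) : R :=
  match n with
  | O => 0
  | S m => match m with
           | O => 1
           | S k => a m * CF_den a b m + b m * CF_den a b k
           end
  end.

(** [is_CF a b l]: the value of CF[a_n, b_n] exists and equals [l].
    Division in R is total, hence the explicit requirement that the
    convergents A_n / B_n be defined for all large n. *)
Definition is_CF (a b : nat -> R) (l : R) : Prop :=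
  eventually (fun n => CF_den a b n <> 0) /\
  is_lim_seq (fun n => CF_num a b n / CF_den a b n) (Finite l).

(* Main.v *)
Require Import Defs.
From Stdlib Require Import Reals Factorial Wf_nat Lra Lia.
From Coquelicot Require Import Coquelicot.
Open Scope R_scope.

(** The recurrence has the solution A_n = n! (n+2) 2^(n-1), and the Casoratian
    of the two solutions is 2^n (n!)^2, so that B_n / A_n telescopes to
    sum_(j<n) 2^(1-j) / ((j+1) (j+2) (j+3)).  By partial fractions this is
    2 S_n - 1 + 2 / ((n+2) 2^n), where S_n = sum_(1<=k<=n) 1 / (k 2^k) is a
    partial sum of the series of - ln (1 - x) at x = 1/2; hence
    B_n / A_n -> 2 ln 2 - 1. *)

(** The point [x] is a variable, since the error estimate differentiates in it. *)
Fixpoint log_sum (x : R) (n : nat) : R :=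
  match n with
  | O => 0
  | S m => log_sum x m + x ^ S m / INR (S m)
  end.

Lemma log_sum_0 (n : nat) : log_sum 0 n = 0.
Proof.
  induction n as [|n IH]; [reflexivity|].
  change (log_sum 0 n + 0 ^ S n / INR (S n) = 0).
  rewrite IH, pow_i by lia. unfold Rdiv; ring.
Qed.

(** Termwise differentiation gives the geometric sum 1 + x + ... + x^(n-1). *)
Lemma is_derive_log_sum (n : nat) (x : R) (hx : x < 1) :
  is_derive (fun y => log_sum y n) x ((1 - x ^ n) / (1 - x)).
Proof.
  induction n as [|n IH].
  - replace ((1 - x ^ 0) / (1 - x)) with 0 by (simpl; field; lra).
    apply (is_derive_const 0 x).
  - replace ((1 - x ^ S n) / (1 - x)) with ((1 - x ^ n) / (1 - x) + x ^ n)
      by (simpl; field; lra).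
    apply (is_derive_plus (fun y => log_sum y n) (fun y => y ^ S n / INR (S n)));
      [exact IH|].
    assert (hn : INR (S n) <> 0) by (apply not_0_INR; lia).
    auto_derive; [exact I|].
    (* [auto_derive] leaves [INR (S n)] unfolded; folding it back lets [hn] apply. *)
    change (match n with O => 1 | S _ => INR n + 1 end) with (INR (S n)).
    now field.
Qed.

(* Mean value theorem for - ln (1 - y) - log_sum y n, whose derivative is y^n / (1 - y). *)
Lemma log_sum_error (x : R) (n : nat) (hx : 0 <= x < 1) :
  Rabs (- ln (1 - x) - log_sum x n) <= x ^ n * (x / (1 - x)).
Proof.
  destruct (MVT_gen (fun y => - ln (1 - y) - log_sum y n) 0 x
              (fun y => y ^ n / (1 - y))) as [c [hc e]].
  - intros y hy. rewrite Rmin_left, Rmax_right in hy by lra.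
    replace (y ^ n / (1 - y)) with (/ (1 - y) - (1 - y ^ n) / (1 - y))
      by (field; lra).
    apply (is_derive_minus (fun y => - ln (1 - y)) (fun y => log_sum y n)).
    + auto_derive; [lra|field; lra].
    + apply is_derive_log_sum; lra.
  - intros y hy. rewrite Rmin_left, Rmax_right in hy by lra.
    apply continuity_pt_filterlim.
    apply (ex_derive_continuous (fun y => - ln (1 - y) - log_sum y n)).
    apply (ex_derive_minus (fun y => - ln (1 - y)) (fun y => log_sum y n)).
    + auto_derive; lra.
    + eexists. apply is_derive_log_sum; lra.
  - rewrite Rmin_left, Rmax_right in hc by lra.
    (* The function vanishes at 0, so [e] expresses the error as c^n / (1 - c) * x. Both c^n and 1 /
       (1 - c) grow with c, and c <= x. *)
    rewrite log_sum_0, (Rminus_0_r 1), ln_1 in e.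
    replace (- ln (1 - x) - log_sum x n) with (c ^ n / (1 - c) * x) by lra.
    assert (h0 : 0 <= c ^ n) by (apply pow_le; lra).
    assert (h1 : c ^ n <= x ^ n) by (apply pow_incr; lra).
    assert (h2 : 0 < / (1 - c)) by (apply Rinv_0_lt_compat; lra).
    assert (h3 : / (1 - c) <= / (1 - x)) by (apply Rinv_le_contravar; lra).
    rewrite Rabs_pos_eq.
    + replace (x ^ n * (x / (1 - x))) with (x ^ n * / (1 - x) * x)
        by (field; lra).
      apply Rmult_le_compat_r; [lra|]. apply Rmult_le_compat; lra.
    + apply Rmult_le_pos; [|lra]. apply Rmult_le_pos; lra.
Qed.

Lemma is_lim_seq_log_sum (x : R) (hx : 0 <= x < 1) :
  is_lim_seq (log_sum x) (- ln (1 - x)).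
Proof.
  assert (hb : is_lim_seq (fun n => x ^ n * (x / (1 - x))) 0).
  { replace (Finite 0) with (Rbar_mult 0 (x / (1 - x)))
      by (simpl; f_equal; ring).
    apply is_lim_seq_scal_r, is_lim_seq_geom. rewrite Rabs_pos_eq; lra. }
  assert (he : is_lim_seq (fun n => - ln (1 - x) - log_sum x n) 0).
  { apply is_lim_seq_abs_0.
    apply is_lim_seq_le_le with (fun _ => 0) (fun n => x ^ n * (x / (1 - x)));
      [|apply is_lim_seq_const|exact hb].
    intro n. split; [apply Rabs_pos|now apply log_sum_error]. }
  apply is_lim_seq_ext with
    (fun n => - ln (1 - x) - (- ln (1 - x) - log_sum x n)).
  { intro n; ring. }
  replace (Finite (- ln (1 - x))) with (Finite (- ln (1 - x) - 0))
    by (f_equal; ring).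
  apply is_lim_seq_minus'; [apply is_lim_seq_const|exact he].
Qed.

(** This is B_n / A_n, inverted because A_n never vanishes while B_0 = 0. *)
Definition convergent_inv (n : nat) : R :=
  2 * log_sum (1 / 2) n - 1 + 2 / (INR n + 2) * (1 / 2) ^ n.

(** The first term 1/2 of the sum already offsets the -1. The index is shifted because the value at
    0 is 0. *)
Lemma convergent_inv_pos (n : nat) : 0 < convergent_inv (S n).
Proof.
  assert (h : forall m, 1 / 2 <= log_sum (1 / 2) (S m)).
  { induction m as [|m IH]; [simpl; lra|].
    change (1 / 2 <= log_sum (1 / 2) (S m) + (1 / 2) ^ S (S m) / INR (S (S m))).
    assert (0 < (1 / 2) ^ S (S m) / INR (S (S m))); [|lra].
    apply Rdiv_lt_0_compat; [apply pow_lt; lra|apply lt_0_INR; lia]. }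
  specialize (h n). unfold convergent_inv.
  assert (0 < 2 / (INR (S n) + 2) * (1 / 2) ^ S n); [|lra].
  apply Rmult_lt_0_compat; [|apply pow_lt; lra].
  apply Rdiv_lt_0_compat; [lra|]. pose proof (pos_INR (S n)); lra.
Qed.

Lemma is_lim_seq_convergent_inv : is_lim_seq convergent_inv (2 * ln 2 - 1).
Proof.
  replace (Finite (2 * ln 2 - 1)) with (Finite (2 * ln 2 - 1 + 0))
    by (f_equal; ring).
  unfold convergent_inv. apply is_lim_seq_plus'.
  - apply is_lim_seq_minus'; [|apply is_lim_seq_const].
    apply (is_lim_seq_scal_l _ 2 (ln 2)).
    replace (ln 2) with (- ln (1 - 1 / 2)).
    + apply is_lim_seq_log_sum; lra.
    + replace (1 - 1 / 2) with (/ 2) by lra. rewrite ln_Rinv; lra.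
  - apply is_lim_seq_le_le with (fun _ => 0) (fun n => (1 / 2) ^ n).
    + intro n. pose proof (pos_INR n).
      assert (0 < (1 / 2) ^ n) by (apply pow_lt; lra).
      assert (0 < 2 / (INR n + 2)) by (apply Rdiv_lt_0_compat; lra).
      assert (2 / (INR n + 2) <= 1)
        by (apply Rmult_le_reg_r with (INR n + 2); [lra|field_simplify; lra]).
      nra.
    + apply is_lim_seq_const.
    + apply is_lim_seq_geom. rewrite Rabs_pos_eq; lra.
Qed.

(** Dividing 2^n by 2 avoids the truncated exponent n - 1 at n = 0. *)
Definition num_closed (n : nat) : R :=
  INR (fact n) * (INR n + 2) * 2 ^ n / 2.

Lemma num_closed_pos (n : nat) : 0 < num_closed n.
Proof.
  unfold num_closed. pose proof (INR_fact_lt_0 n). pose proof (pos_INR n).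
  assert (0 < 2 ^ n) by (apply pow_lt; lra).
  apply Rdiv_lt_0_compat; [|lra].
  apply Rmult_lt_0_compat; [|lra]. apply Rmult_lt_0_compat; lra.
Qed.

Lemma fact_INR_S (n : nat) : INR (fact (S n)) = (INR n + 1) * INR (fact n).
Proof. now rewrite fact_simpl, mult_INR, S_INR. Qed.

Lemma num_closed_rec (n : nat) :
  num_closed (S (S n)) =
  (3 * INR (S n) + 3) * num_closed (S n) + -2 * INR (S n) ^ 2 * num_closed n.
Proof.
  unfold num_closed. rewrite !fact_INR_S, !S_INR. simpl pow. field.
Qed.

(** Once the sums are expanded down to [log_sum (1 / 2) n], its coefficient cancels by the
    recurrence of [num_closed]; a rational identity in n and 2^n remains. *)
Lemma den_closed_rec (n : nat) :
  num_closed (S (S n)) * convergent_inv (S (S n)) =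
  (3 * INR (S n) + 3) * (num_closed (S n) * convergent_inv (S n)) +
  -2 * INR (S n) ^ 2 * (num_closed n * convergent_inv n).
Proof.
  unfold num_closed, convergent_inv. cbn [log_sum].
  rewrite !fact_INR_S, !S_INR.
  pose proof (pos_INR n).
  (* All powers are brought to the single atom 2^n for [field]. *)
  replace ((1 / 2) ^ n) with (/ 2 ^ n) by (rewrite <- pow_inv; f_equal; lra).
  cbn [pow].
  replace ((1 / 2) ^ n) with (/ 2 ^ n) by (rewrite <- pow_inv; f_equal; lra).
  assert (2 ^ n <> 0) by (apply pow_nonzero; lra).
  field. repeat split; lra.
Qed.

Lemma CF_num_closed (n : nat) :
  CF_num (fun n => 3 * INR n + 3) (fun n => -2 * INR n ^ 2) n = num_closed n.
Proof.
  induction n as [n IH] using lt_wf_ind. destruct n as [|[|n]].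
  - unfold num_closed; simpl; lra.
  - unfold num_closed; simpl; lra.
  - rewrite num_closed_rec, <- (IH n), <- (IH (S n)) by lia. reflexivity.
Qed.

Lemma CF_den_closed (n : nat) :
  CF_den (fun n => 3 * INR n + 3) (fun n => -2 * INR n ^ 2) n =
  num_closed n * convergent_inv n.
Proof.
  induction n as [n IH] using lt_wf_ind. destruct n as [|[|n]].
  - unfold num_closed, convergent_inv; simpl; lra.
  - unfold num_closed, convergent_inv; simpl; lra.
  - rewrite den_closed_rec, <- (IH n), <- (IH (S n)) by lia. reflexivity.
Qed.

Theorem theorem3p2 :
  is_CF (fun n => 3 * INR n + 3) (fun n => -2 * INR n ^ 2)
        (1 / (-1 + 2 * ln 2)).
Proof.
  split.
  - exists 1%nat. intros [|n] hn; [lia|]. rewrite CF_den_closed.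
    pose proof (num_closed_pos (S n)). pose proof (convergent_inv_pos n). nra.
  (* The shift skips n = 0, where the convergent would divide by B_0 = 0. *)
  - apply is_lim_seq_incr_1.
    apply is_lim_seq_ext with (fun n => / convergent_inv (S n)).
    { intro n. rewrite CF_num_closed, CF_den_closed.
      pose proof (num_closed_pos (S n)). pose proof (convergent_inv_pos n).
      field; lra. }
    replace (Finite (1 / (-1 + 2 * ln 2))) with (Rbar_inv (2 * ln 2 - 1)).
    + apply is_lim_seq_inv.
      * apply (is_lim_seq_incr_1 convergent_inv), is_lim_seq_convergent_inv.
      (* [ln_lt_2] says 1/2 < ln 2, so the limit to be inverted is positive. *)
      * intro h. injection h. pose proof ln_lt_2. lra.
    + simpl. f_equal. pose proof ln_lt_2. field; lra.
Qed.
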